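(* Let $R$ be a P$v$MD. The following conditions are equivalent: (i) $R$ satisfies the ascending chain condition on radical $t$-ideals; (ii) $R$ is a $tRTP$-domain satisfying the ascending chain condition on prime $t$-ideals; (iii) $R$ is a $t\#\#$-domain satisfying the ascending chain condition on prime $t$-ideals; (iv) $R$ is a $t\#\#$-domain and each $t$-prime is branched.
   Context: $R$ is an integral domain with quotient field $K\neq R$. For nonzero $R$-submodules $A,B$ of $K$, $(A:B)=\{x\in K: xB\subseteq A\}$. For a nonzero fractional ideal $I$, $I_v=(R:(R:I))$, $I_t=\bigcup\{J_v: J\subseteq I\text{ nonzero finitely generated}\}$; $I$ is a $t$-ideal if $I=I_t$; a $t$-prime is a prime $t$-ideal; a $t$-maximal ideal is an ideal maximal among proper $t$-ideals. $R$ is a P$v$MD if $R_M$ is a valuation domain for every $t$-maximal $M$. A prime $P$ is branched if there is a $P$-primary ideal different from $P$. $R$ is a $t\#\#$-domain if $\bigcap_{P\in\mathcal P_1}R_P\neq\bigcap_{P\in\mathcal P_2}R_P$ for any two distinct sets $\mathcal P_1,\mathcal P_2$ of pairwise incomparable $t$-prime ideals. $R$ is a $tRTP$-domain if for each nonzero ideal $I$, either $(I(R:I))_t=R$ or $(I(R:I))_t$ is a radical ideal. *)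

(* Defs.v *)
From HB Require Import structures.
From mathcomp Require Import all_boot all_order all_algebra.
From mathcomp Require Import boolp classical_sets.
Set Implicit Arguments. Unset Strict Implicit. Unset Printing Implicit Defensive.
Import GRing.Theory.
Local Open Scope ring_scope.
Local Open Scope classical_set_scope.

(* The integral domain R is modelled as a subring R of a field K such that K
   is the quotient field of R. All "sets" below are subsets of K. *)
Section Defs.
Variables (K : fieldType) (R : set K).

Definition subring : Prop :=
  R 1 /\ (forall x y, R x -> R y -> R (x - y)) /\
  (forall x y, R x -> R y -> R (x * y)).
Definition quotient_field_of : Prop :=
  forall x : K, exists a b, R a /\ R b /\ b != 0 /\ x = a / b.
Definition domain_with_qf : Prop :=
  subring /\ quotient_field_of /\ R <> setT.

Definition submodule (A : set K) : Prop :=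
  A 0 /\ (forall x y, A x -> A y -> A (x + y)) /\
  (forall r x, R r -> A x -> A (r * x)).
Definition nonzero (A : set K) : Prop := exists x, A x /\ x != 0.

Definition colon (A B : set K) : set K :=
  [set x | forall b, B b -> A (x * b)].

Definition prodm (A B : set K) : set K :=
  [set x | exists n (a b : 'I_n -> K),
     (forall i, A (a i) /\ B (b i)) /\ x = \sum_(i < n) a i * b i].

Definition span (s : seq K) : set K :=
  [set x | exists c : 'I_(size s) -> K,
     (forall i, R (c i)) /\ x = \sum_(i < size s) c i * s`_i].
Definition fin_gen (J : set K) : Prop := exists s : seq K, J = span s.

Definition fractional (I : set K) : Prop :=
  submodule I /\ exists d, R d /\ d != 0 /\ forall x, I x -> R (d * x).

Definition vclos (I : set K) : set K := colon R (colon R I).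
Definition tclos (I : set K) : set K :=
  [set x | exists J, fin_gen J /\ nonzero J /\ J `<=` I /\ vclos J x].

Definition ideal (I : set K) : Prop := submodule I /\ I `<=` R.
Definition t_ideal (I : set K) : Prop := ideal I /\ nonzero I /\ tclos I = I.

Definition prime_ideal (P : set K) : Prop :=
  ideal P /\ ~ P 1 /\
  forall x y, R x -> R y -> P (x * y) -> P x \/ P y.
Definition t_prime (P : set K) : Prop := prime_ideal P /\ t_ideal P.

Definition t_maximal (M : set K) : Prop :=
  t_ideal M /\ M <> R /\
  forall I, t_ideal I -> I <> R -> M `<=` I -> I = M.

Definition rad (I : set K) : set K := [set x | R x /\ exists n, I (x ^+ n)].
Definition radical (I : set K) : Prop := rad I `<=` I.

Definition localization (P : set K) : set K :=
  [set x | exists a s, R a /\ R s /\ ~ P s /\ x = a / s].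

(* a subring D of K (with quotient field K) is a valuation domain *)
Definition valuation_domain (D : set K) : Prop :=
  forall x : K, x != 0 -> D x \/ D x^-1.

Definition PvMD : Prop :=
  forall M, t_maximal M -> valuation_domain (localization M).

Definition primary (Q : set K) : Prop :=
  ideal Q /\ ~ Q 1 /\
  forall x y, R x -> R y -> Q (x * y) -> Q x \/ exists n, Q (y ^+ n).
Definition branched (P : set K) : Prop :=
  exists Q, primary Q /\ rad Q = P /\ Q <> P.

Definition incomparable_family (F : set (set K)) : Prop :=
  forall P Q, F P -> F Q -> P `<=` Q -> P = Q.
Definition loc_inter (F : set (set K)) : set K :=
  [set x | forall P, F P -> localization P x].
Definition t_sharpsharp : Prop :=
  forall F1 F2 : set (set K),
    F1 `<=` t_prime -> F2 `<=` t_prime ->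
    incomparable_family F1 -> incomparable_family F2 ->
    F1 <> F2 -> loc_inter F1 <> loc_inter F2.

Definition tRTP : Prop :=
  forall I, ideal I -> nonzero I ->
    tclos (prodm I (colon R I)) = R \/ radical (tclos (prodm I (colon R I))).

Definition ACC (C : set K -> Prop) : Prop :=
  forall c : nat -> set K, (forall n, C (c n)) ->
    (forall n, c n `<=` c n.+1) ->
    exists N, forall n, (N <= n)%N -> c n = c N.

Definition radical_t_ideal (I : set K) : Prop := t_ideal I /\ radical I.
End Defs.

(* Main.v *)
(** In a PvMD the t-primes are exactly the nonzero primes P such that R_P is a
    valuation domain; in particular the primes inside a t-prime form a chain.
    Each of the four conditions is equivalent to: every t-prime P contains a
    finite set s such that all t-primes containing s contain P ([radfin]). A
    Cohen-Kaplansky argument extends this from t-primes to radical t-ideals,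
    which is the chain condition (i). The property splits into two parts: a
    finite s in P such that the t-maximal ideals containing s contain P
    ([sharp]), which follows from t## as well as from tRTP, and an element of P
    outside all smaller primes ([summit]), whose existence means that P is
    branched and follows from the chain condition on t-primes. *)
Require Import Defs.
From mathcomp Require Import all_boot all_order all_algebra.
From mathcomp Require Import boolp classical_sets.
From mathcomp Require Import ring.

Section PruferVMultiplication.
Import GRing.Theory.
Local Open Scope ring_scope.
Local Open Scope classical_set_scope.

(** * Zorn's lemma above a given set, and finite lists of elements *)

Lemma zorn_above (T : Type) (good : set (set T)) (W : set T) :
  good W ->
  (forall F : set (set T), F !=set0 -> F `<=` good -> total_on F subset ->
     good (\bigcup_(X in F) X)) ->
  exists M, [/\ W `<=` M, good M & forall B, good B -> M `<=` B -> B = M].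
Proof.
move=> gW gU.
(* [Zorn_bigcup] also asks about the empty chain; once [W] is joined to every member, its union
   becomes [W] itself. *)
have [F Fg Ft|A [gA Amax]] := @Zorn_bigcup T (fun B => good (W `|` B)).
  have [[X FX]|F0] := pselect (F !=set0); last first.
    rewrite (_ : W `|` _ = W) //; apply/seteqP; split=> x; last by left.
    by case=> // -[X FX _]; case: F0; exists X.
  rewrite (_ : W `|` _ = \bigcup_(Y in [set W `|` X | X in F]) Y); last first.
    apply/seteqP; split=> x.
      case=> [Wx|[Y FY Yx]]; first by exists (W `|` X); [exists X | left].
      by exists (W `|` Y); [exists Y | right].
    by move=> [_ [Y FY <-] [Wx|Yx]]; [left | right; exists Y].
  apply: gU; first by exists (W `|` X), X.
    by move=> _ [Y FY <-]; apply: Fg.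
  move=> _ _ [Y FY <-] [Z FZ <-].
  by case: (Ft _ _ FY FZ) => sYZ; [left | right]; apply: setUS.
exists (W `|` A); split=> // B gB sB; apply: contrapT => neB.
apply: (Amax B); last first.
  by rewrite setUidr // => x Wx; apply: sB; left.
split; first by move=> x Ax; apply: sB; right.
by move=> sBA; apply: neB; apply/seteqP; split=> // x /sBA; right.
Qed.

Variables (K : fieldType) (R : set K).
Hypothesis domR : domain_with_qf R.

Definition lsub (s : seq K) (A : set K) : Prop := forall a, a \in s -> A a.

Lemma lsub_cons x s A : A x -> lsub s A -> lsub (x :: s) A.
Proof. by move=> Ax sA a; rewrite inE => /predU1P[->|/sA]. Qed.

Lemma lsub_consE x s A : lsub (x :: s) A -> A x /\ lsub s A.
Proof.
by move=> sA; split=> [|a sa]; apply: sA; rewrite inE ?eqxx ?sa ?orbT.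
Qed.

Lemma lsub_cat s1 s2 A : lsub (s1 ++ s2) A <-> lsub s1 A /\ lsub s2 A.
Proof.
split=> [sA|[s1A s2A] a]; last by rewrite mem_cat => /orP[/s1A|/s2A].
by split=> a sa; apply: sA; rewrite mem_cat sa ?orbT.
Qed.

Lemma lsub_trans s A B : lsub s A -> A `<=` B -> lsub s B.
Proof. by move=> sA AB a /sA/AB. Qed.

(** The witnesses for the finitely many members of [w] are concatenated; monotonicity of [P] lets
    the long list serve each of them. *)
Lemma seq_collect (A : set K) (P : K -> seq K -> Prop) (w : seq K) :
  (forall x s s', P x s -> {subset s <= s'} -> P x s') ->
  (forall x, x \in w -> exists2 s, lsub s A & P x s) ->
  exists2 s, lsub s A & forall x, x \in w -> P x s.
Proof.
move=> Pmono; elim: w => [|x w IHw] Pw; first by exists [::].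
have [|s sA sP] := IHw; first by move=> y wy; apply: Pw; rewrite inE wy orbT.
have [s' s'A s'P] := Pw x (mem_head _ _).
exists (s' ++ s); first by apply/lsub_cat.
move=> y; rewrite inE => /predU1P[->|/sP Py].
  by apply: Pmono s'P _ => a; rewrite mem_cat => ->.
by apply: Pmono Py _ => a; rewrite mem_cat orbC => ->.
Qed.

(** Through this, finitary conditions pass to unions of chains, as Zorn's lemma requires. *)
Lemma chain_lsub (F : set (set K)) (s : seq K) :
  F !=set0 -> total_on F subset -> lsub s (\bigcup_(X in F) X) ->
  exists2 X, F X & lsub s X.
Proof.
move=> [X0 FX0] Ft; elim: s => [|x s IHs]; first by exists X0.
move=> /lsub_consE[[Y FY Yx] /IHs[X FX sX]].
case: (Ft _ _ FX FY) => sub; last by exists X => //; apply: lsub_cons => //; apply: sub.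
by exists Y => //; apply: lsub_cons => //; apply: lsub_trans sX sub.
Qed.

(** * Ideals and the t-closure *)

Lemma dom1 : R 1. Proof. by case: domR => -[]. Qed.

Lemma domB x y : R x -> R y -> R (x - y).
Proof. by case: domR => -[_ [RB _]] _; apply: RB. Qed.

Lemma domM x y : R x -> R y -> R (x * y).
Proof. by case: domR => -[_ [_ RM]] _; apply: RM. Qed.

Lemma dom0 : R 0.
Proof. by rewrite -(subrr 1); apply: domB; apply: dom1. Qed.

Lemma domD x y : R x -> R y -> R (x + y).
Proof. by move=> Rx Ry; rewrite -[y]opprK -[- y]sub0r; do !apply: domB => //; apply: dom0. Qed.

Lemma domX x n : R x -> R (x ^+ n).
Proof.
by move=> Rx; elim: n => [|n IHn]; rewrite ?expr0 ?exprS; [apply: dom1 | apply: domM].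
Qed.

Lemma sub0 A : submodule R A -> A 0.
Proof. by case. Qed.

Lemma subD A x y : submodule R A -> A x -> A y -> A (x + y).
Proof. by case=> _ [AD _]; apply: AD. Qed.

Lemma subMl A r x : submodule R A -> R r -> A x -> A (r * x).
Proof. by case=> _ [_ AM]; apply: AM. Qed.

Lemma subMr A x r : submodule R A -> A x -> R r -> A (x * r).
Proof. by move=> sA Ax Rr; rewrite mulrC; apply: subMl. Qed.

Lemma dom_ideal : ideal R R.
Proof. by split=> //; split; [apply: dom0 | split; [apply: domD | apply: domM]]. Qed.

Lemma primeM P x y : prime_ideal R P -> R x -> R y -> ~ P x -> ~ P y -> ~ P (x * y).
Proof. by move=> [_ [_ pP]] Rx Ry Px Py /(pP _ _ Rx Ry)[]. Qed.

Lemma primeX P x n : prime_ideal R P -> R x -> P (x ^+ n) -> P x.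
Proof.
move=> pP Rx; elim: n => [|n IHn]; first by rewrite expr0; case: pP => _ [].
by rewrite exprS; case: pP => _ [_ pP] /(pP _ _ Rx (domX _ n Rx))[].
Qed.

Lemma prime_cancel P d x : prime_ideal R P -> R d -> R x -> ~ P d -> P (d * x) -> P x.
Proof. by move=> [_ [_ pP]] Rd Rx Pd /(pP _ _ Rd Rx)[]. Qed.

Lemma localizationP P x : P 0 ->
  localization R P x <-> exists d, [/\ R d, ~ P d & R (d * x)].
Proof.
move=> P0; split=> [[a [d [Ra [Rd [Pd ->]]]]]|[d [Rd Pd Rdx]]].
  exists d; split=> //; rewrite mulrC divfK //.
  by apply/eqP => d0; apply: Pd; rewrite d0.
exists (d * x), d; do ![split=> //]; rewrite mulrC mulKf //.
by apply/eqP => d0; apply: Pd; rewrite d0.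
Qed.

(* [x] lies in the v-closure of the submodule generated by [s]. *)
Definition vgen (s : seq K) (x : K) : Prop :=
  forall y, (forall a, a \in s -> R (y * a)) -> R (y * x).

Lemma vgenS x s s' : vgen s x -> {subset s <= s'} -> vgen s' x.
Proof. by move=> sx ss' y ys'; apply: sx => a /ss'; apply: ys'. Qed.

Lemma vgen_mem s x : x \in s -> vgen s x.
Proof. by move=> sx y; apply. Qed.

Lemma span_mem s a : a \in s -> Defs.span R s a.
Proof.
move=> sa; have lt_a : (index a s < size s)%N by rewrite index_mem.
exists (fun i => (i == Ordinal lt_a)%:R); split.
  by move=> i; case: eqP => _; [apply: dom1 | apply: dom0].
rewrite (bigD1 (Ordinal lt_a)) //= eqxx mul1r nth_index // big1 ?addr0 //.
by move=> i /negPf->; rewrite mul0r.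
Qed.

Lemma sub_sum A n (f : 'I_n -> K) :
  submodule R A -> (forall i, A (f i)) -> A (\sum_(i < n) f i).
Proof.
move=> sA fA; elim/big_ind: _ => //; first exact: sub0.
by move=> x y; apply: subD.
Qed.

Lemma span_sub s A : submodule R A -> lsub s A -> Defs.span R s `<=` A.
Proof.
move=> sA sub _ [c [Rc ->]]; apply: sub_sum => // i.
by apply: subMl => //; apply: sub; apply: mem_nth.
Qed.

Lemma tclosP A x : submodule R A -> nonzero A ->
  tclos R A x <-> exists2 s, lsub s A & vgen s x.
Proof.
move=> sA [a0 [Aa0 a0_neq0]]; split.
  move=> [_ [[s ->] [_ [sub vx]]]]; exists s.
    by move=> a /span_mem; apply: sub.
  move=> y ys; rewrite mulrC; apply: vx => _ [c [Rc ->]].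
  rewrite mulr_sumr; apply: sub_sum; first by case: dom_ideal.
  by move=> i; rewrite mulrCA; apply: domM => //; apply: ys; apply: mem_nth.
(* The nonzero [a0] is added because [tclos] admits only nonzero [J], while [s] may be empty. *)
move=> [s sub vx]; exists (Defs.span R (a0 :: s)); split; first by exists (a0 :: s).
split; first by exists a0; split=> //; apply: span_mem; apply: mem_head.
split; first by apply: span_sub => //; apply: lsub_cons.
move=> y ys; rewrite mulrC; apply: vx => a sa; apply: ys; apply: span_mem.
by rewrite inE sa orbT.
Qed.

Section Closure.
Variable A : set K.
Hypotheses (iA : ideal R A) (nA : nonzero A).
Let sA : submodule R A := proj1 iA.

Lemma sub_tclos : A `<=` tclos R A.
Proof.
move=> x Ax; apply/tclosP => //; exists [:: x]; last exact/vgen_mem/mem_head.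
by apply: lsub_cons.
Qed.

Lemma tclos_dom : tclos R A `<=` R.
Proof.
move=> x /tclosP[]// s sub vx; rewrite -[x]mul1r; apply: vx => a /sub Aa.
by rewrite mul1r; apply: (proj2 iA).
Qed.

Lemma tclos_ideal : ideal R (tclos R A).
Proof.
split; last exact: tclos_dom.
split; first by apply: sub_tclos; apply: sub0.
split=> [x y /tclosP[]// s1 sub1 v1 /tclosP[]// s2 sub2 v2|r x Rr /tclosP[]// s sub v].
  apply/tclosP => //; exists (s1 ++ s2); first exact/lsub_cat.
  move=> z zs; rewrite mulrDr; apply: domD; [apply: v1 | apply: v2];
    by move=> a sa; apply: zs; rewrite mem_cat sa ?orbT.
by apply/tclosP => //; exists s => // y /v; rewrite mulrCA; apply: domM.
Qed.

Lemma tclos_nonzero : nonzero (tclos R A).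
Proof. by case: nA => x [Ax x0]; exists x; split=> //; apply: sub_tclos. Qed.

End Closure.

Lemma tclos_idem A : ideal R A -> nonzero A -> tclos R (tclos R A) = tclos R A.
Proof.
move=> iA nA; have iT := tclos_ideal _ iA nA; have nT := tclos_nonzero _ iA nA.
apply/seteqP; split; last exact: sub_tclos.
move=> x /tclosP[]//; first by case: iT.
move=> s sub vx; have [||s' s'A s's] := @seq_collect A (fun x s => vgen s x) s.
- by move=> y s1 s2; apply: vgenS.
- by move=> y /sub/tclosP; apply=> //; case: iA.
apply/tclosP => //; first by case: iA.
by exists s' => // y ys'; apply: vx => a sa; apply: s's.
Qed.

Lemma t_ideal_tclos A : ideal R A -> nonzero A -> t_ideal R (tclos R A).
Proof.
by move=> iA nA; split; [|split]; [apply: tclos_ideal|apply: tclos_nonzero|apply: tclos_idem].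
Qed.

Lemma t_idealP A : ideal R A -> nonzero A ->
  (forall s x, lsub s A -> vgen s x -> R x -> A x) -> t_ideal R A.
Proof.
move=> iA nA clA; do 2![split=> //]; apply/seteqP; split; last exact: sub_tclos.
move=> x Tx; have Rx := tclos_dom _ iA nA _ Tx.
by case/tclosP: Tx => //; [case: iA | move=> s sA vx; apply: clA sA vx Rx].
Qed.

Lemma t_ideal_vgen A s x : t_ideal R A -> lsub s A -> vgen s x -> A x.
Proof.
move=> [[sA _] [nA TA]] sub vx; rewrite -TA.
by apply/tclosP => //; exists s.
Qed.

Lemma t_ideal_bigcup (F : set (set K)) : F !=set0 -> total_on F subset ->
  F `<=` t_ideal R -> t_ideal R (\bigcup_(X in F) X).
Proof.
move=> F0 Ft Ftid; have [X0 FX0] := F0; apply: t_idealP.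
- split; last by move=> x [X /Ftid[[_ XR] _] /XR].
  split; first by exists X0 => //; case: (Ftid _ FX0) => -[[]].
  split=> [x y Ux Uy|r x Rr [X FX Xx]]; last first.
    by exists X => //; apply: subMl => //; case: (Ftid _ FX) => -[].
  have sxy : lsub [:: x; y] (\bigcup_(X in F) X).
    by apply: lsub_cons => //; apply: lsub_cons.
  have [X FX /lsub_consE[Xx /lsub_consE[Xy _]]] := chain_lsub _ _ F0 Ft sxy.
  by exists X => //; apply: subD => //; case: (Ftid _ FX) => -[].
- have [_ [[x [Xx x0]] _]] := Ftid _ FX0.
  by exists x; split=> //; exists X0.
move=> s x sU vx Rx; have [X FX sX] := chain_lsub _ _ F0 Ft sU.
by exists X => //; apply: t_ideal_vgen sX vx; apply: Ftid.
Qed.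

Lemma t_maximal_above W : ideal R W -> nonzero W -> ~ tclos R W 1 ->
  exists2 M, t_maximal R M & W `<=` M.
Proof.
move=> iW nW W1.
have [|F F0 Fg Ft|M [WM [tM M1] Mmax]] :=
  @zorn_above K (fun B => t_ideal R B /\ ~ B 1) (tclos R W).
- by split=> //; apply: t_ideal_tclos.
- split; first by apply: t_ideal_bigcup => // X /Fg[].
  by move=> [X /Fg[_ X1]].
exists M; last by move=> x /(sub_tclos _ iW nW)/WM.
split=> //; split; first by move=> eMR; apply: M1; rewrite eMR; apply: dom1.
move=> I tI neI MI; apply: Mmax => //; split=> // I1; apply: neI.
apply/seteqP; split=> [|x Rx]; first by case: tI => -[].
by rewrite -[x]mulr1; apply: subMl => //; case: tI => -[].
Qed.

Lemma t_maximal_proper M : t_maximal R M -> ~ M 1.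
Proof.
move=> [[[sM MR] _] [neM _]] M1; apply: neM; apply/seteqP; split=> // x Rx.
by rewrite -[x]mulr1; apply: subMl.
Qed.

Lemma t_maximal_sub M I : t_maximal R M -> t_ideal R I -> ~ I 1 -> M `<=` I -> I = M.
Proof.
move=> [_ [_ Mmax]] tI I1; apply: Mmax => // eI; apply: I1.
by rewrite eI; apply: dom1.
Qed.

(** If [a * b] is in [M] but [a] is not, maximality puts 1 in the t-closure of [M + R a].
    Multiplying a finite witness of this by [b] gives a list in [M] whose v-closure contains [b]. *)
Lemma t_maximal_prime M : t_maximal R M -> prime_ideal R M.
Proof.
move=> maxM; have [tM _] := maxM; have [[sM MR] [nM _]] := tM.
split=> //; split; first exact: t_maximal_proper.
move=> a b Ra Rb Mab; apply: contrapT => /not_orP[Ma Mb].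
pose W := [set x | exists m r, [/\ M m, R r & x = m + r * a]].
have MW : M `<=` W by move=> m Mm; exists m, 0; split; rewrite ?mul0r ?addr0 //; apply: dom0.
have Wa : W a.
  by exists 0, 1; split; rewrite ?mul1r ?add0r //; [apply: sub0 | apply: dom1].
have iW : ideal R W.
  split; last first.
    by move=> _ [m [r [Mm Rr ->]]]; apply: domD; [apply: MR | apply: domM].
  split; first by apply: MW; apply: sub0.
  split=> [_ _ [m [r [Mm Rr ->]]] [m' [r' [Mm' Rr' ->]]]|c _ Rc [m [r [Mm Rr ->]]]].
    exists (m + m'), (r + r'); split; [exact: subD|exact: domD|ring].
  exists (c * m), (c * r); split; [exact: subMl|exact: domM|ring].
have nW : nonzero W by have [x [Mx x0]] := nM; exists x; split=> //; apply: MW.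
have [W1|W1] := pselect (tclos R W 1); last first.
  have [M' maxM' WM'] := t_maximal_above _ iW nW W1.
  apply: Ma; suff <- : M' = M by apply: WM'.
  apply: t_maximal_sub => //; first by case: maxM'.
    exact: t_maximal_proper.
  by move=> x /MW/WM'.
case/tclosP: W1 => //; first by case: iW.
move=> s sW v1; apply: Mb; apply: (t_ideal_vgen M [seq b * x | x <- s]) => //.
  move=> _ /mapP[x /sW[m [r [Mm Rr ->]]] ->].
  rewrite mulrDr (_ : b * (r * a) = r * (a * b)); last by ring.
  by apply: subD => //; apply: subMl.
move=> y ys; rewrite -[y * b]mulr1; apply: v1 => x sx.
by rewrite -mulrA; apply: ys; apply: map_f.
Qed.

(** * Essential primes *)

Definition essential (P : set K) : Prop :=
  [/\ prime_ideal R P, nonzero P & valuation_domain (localization R P)].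

Lemma prime0 P : prime_ideal R P -> P 0.
Proof. by case=> -[[]]. Qed.

(** This is the valuation property of [R_P] with denominators cleared, so that [a] and [b] may be
    zero. *)
Lemma essential_cmp P a b : essential P ->
  exists d, [/\ R d, ~ P d &
    (exists2 r, R r & d * a = b * r) \/ (exists2 r, R r & d * b = a * r)].
Proof.
move=> [pP _ vP]; have P0 := prime0 _ pP; have [_ [P1 _]] := pP.
have [->|a0] := eqVneq a 0.
  exists 1; split=> //; first exact: dom1.
  by left; exists 0; [apply: dom0 | rewrite !mulr0].
have [->|b0] := eqVneq b 0.
  exists 1; split=> //; first exact: dom1.
  by right; exists 0; [apply: dom0 | rewrite !mulr0].
have ab0 : a / b != 0 by rewrite mulf_neq0 ?invr_eq0.
case: (vP _ ab0) => /(localizationP _ _ P0)[d [Rd Pd Rx]]; exists d; split=> //.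
  by left; exists (d * (a / b)) => //; field.
by right; exists (d * (a / b)^-1) => //; field; rewrite a0 b0.
Qed.

(** Over a valuation domain a finitely generated module inside [K] is generated by one of the given
    generators; [d] is a common denominator for the divisions. *)
Lemma essential_gen P s : essential P -> s != [::] ->
  exists2 g, g \in s & exists d, [/\ R d, ~ P d &
    forall a, a \in s -> exists2 r, R r & d * a = g * r].
Proof.
move=> eP; have [pP _ _] := eP; have [_ [P1 _]] := pP.
elim: s => // a [_ _|b s /(_ isT)[g gs [d [Rd Pd gd]]] _].
  exists a; first exact: mem_head.
  exists 1; split=> //; first exact: dom1.
  by move=> x; rewrite inE => /eqP->; exists 1; [apply: dom1 | rewrite mulrC].
have [e [Re Pe [[r Rr er]|[r Rr er]]]] := essential_cmp _ a g eP.
  exists g; first by rewrite inE gs orbT.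
  exists (d * e); split; [exact: domM|exact: primeM|move=> x].
  rewrite inE => /predU1P[->|/gd[r' Rr' dr']].
    by exists (d * r); [apply: domM | rewrite -mulrA er; ring].
  by exists (e * r'); [apply: domM | rewrite mulrAC dr'; ring].
exists a; first exact: mem_head.
exists (d * e); split; [exact: domM|exact: primeM|move=> x].
rewrite inE => /predU1P[->|/gd[r' Rr' dr']].
  by exists (d * e); [apply: domM | rewrite mulrC].
exists (r * r'); first exact: domM.
by rewrite mulrAC dr' mulrAC [g * e]mulrC er mulrA.
Qed.

Lemma prime_neq0 P d : prime_ideal R P -> ~ P d -> d != 0.
Proof. by move=> pP Pd; apply/eqP => d0; apply: Pd; rewrite d0; apply: prime0. Qed.

(** The module spanned by [s] is invertible at [P]: [d / g] lies in its inverse, and its product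
    with [g] is [d], a unit of [R_P]. *)
Lemma essential_inverse P (s : seq K) a : essential P -> a \in s -> a != 0 ->
  exists2 g, g \in s & exists d, [/\ R d, ~ P d, g != 0 &
    forall b, b \in s -> R (d / g * b)].
Proof.
move=> eP sa a0; have [pP _ _] := eP.
have [|g sg [d [Rd Pd gd]]] := essential_gen _ s eP; first by case: s sa.
have g0 : g != 0.
  apply/eqP => g0; have [r _ /eqP] := gd a sa.
  by rewrite g0 mul0r mulf_eq0 (negPf a0) (negPf (prime_neq0 _ _ pP Pd)).
exists g => //; exists d; split=> // b /gd[r Rr dr].
by rewrite mulrAC dr mulrC mulKf.
Qed.

Lemma essential_vgen P s x a : essential P -> a \in s -> a != 0 -> vgen s x ->
  exists2 g, g \in s & exists d r, [/\ R d, ~ P d, R r & d * x = g * r].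
Proof.
move=> eP sa a0 vx.
have [g sg [d [Rd Pd g0 dg]]] := essential_inverse _ s a eP sa a0.
by exists g => //; exists d, (d / g * x); split=> //; [apply: vx | field].
Qed.

(** Locally at [P], the v-closure of a finite list is still generated by one member of the list, so
    the t-closure adds nothing after localization. *)
Lemma essential_tclos P A x : essential P -> ideal R A -> nonzero A -> tclos R A x ->
  exists d, [/\ R d, ~ P d & A (d * x)].
Proof.
move=> eP iA nA; have [sA _] := iA; have [a [Aa a0]] := nA.
case/tclosP => // s As vx.
have [|||g sg [d [r [Rd Pd Rr dx]]]] := essential_vgen _ (a :: s) x a eP.
- exact: mem_head.
- by [].
- by apply: vgenS vx _ => b sb; rewrite inE sb orbT.
exists d; split=> //; rewrite dx; apply: subMr => //.
by move: sg; rewrite inE => /predU1P[->|/As].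
Qed.

Lemma essential_t_prime P : essential P -> t_prime R P.
Proof.
move=> eP; have [pP nP _] := eP; have [iP _] := pP; split=> //.
apply: t_idealP => // s x sP vx Rx.
have [|d [Rd Pd Pdx]] := essential_tclos _ _ x eP iP nP.
  by apply/tclosP => //; [case: iP | exists s].
exact: prime_cancel Pdx.
Qed.

(** [R_P] contains [R_Q], and overrings of a valuation domain are valuation domains. *)
Lemma essential_sub P Q : essential Q -> prime_ideal R P -> nonzero P -> P `<=` Q ->
  essential P.
Proof.
move=> [pQ _ vQ] pP nP PQ; split=> // x x0.
have lPQ z : localization R Q z -> localization R P z.
  case/(localizationP _ _ (prime0 _ pQ)) => d [Rd Qd Rdz].
  by apply/localizationP; [apply: prime0 | exists d; split=> // /PQ].
by case: (vQ x x0) => /lPQ; [left | right].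
Qed.

(** * Passing between [R] and its localizations at t-maximal ideals *)

Lemma tclos1 W : ideal R W -> nonzero W -> (forall M, t_maximal R M -> ~ W `<=` M) ->
  exists2 s, lsub s W & vgen s 1.
Proof.
move=> iW nW WM; apply/tclosP => //; first by case: iW.
by apply: contrapT => /(t_maximal_above _ iW nW)[M /WM].
Qed.

Lemma t_ideal_sub_max I : t_ideal R I -> ~ I 1 -> exists2 M, t_maximal R M & I `<=` M.
Proof. by move=> [iI [nI TI]] I1; apply: t_maximal_above; rewrite ?TI. Qed.

Lemma t_finite_char W : ideal R W -> nonzero W ->
  (forall M, t_maximal R M -> ~ W `<=` M) ->
  exists2 w, lsub w W & forall P, t_prime R P -> ~ lsub w P.
Proof.
move=> iW nW WM; have [w sw v1] := tclos1 _ iW nW WM; exists w => // P [pP tP] wP.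
by have [_ [+ _]] := pP; apply; apply: t_ideal_vgen wP v1.
Qed.

(** The denominators of [x] form an ideal contained in no t-maximal ideal, so 1 is in the v-closure
    of finitely many of them, and [x] multiplies these into [R]. *)
Lemma dom_local x : (forall M, t_maximal R M -> localization R M x) -> R x.
Proof.
move=> locx; pose W := [set r | R r /\ R (r * x)].
have iW : ideal R W.
  split; last by move=> r [].
  split; first by split; rewrite ?mul0r; apply: dom0.
  split=> [a b [Ra Rax] [Rb Rbx]|r a Rr [Ra Rax]].
    by split; rewrite ?mulrDl; apply: domD.
  by split; rewrite -?mulrA; apply: domM.
have nW : nonzero W.
  have [_ [qf _]] := domR; have [a [b [Ra [Rb [b0 ex]]]]] := qf x.
  by exists b; split=> //; split=> //; rewrite ex mulrC divfK.
have [M maxM WM|s sW v1] := tclos1 _ iW nW.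
  have pM := t_maximal_prime _ maxM.
  have [d [Rd Md Rdx]] := (localizationP _ _ (prime0 _ pM)).1 (locx M maxM).
  by apply: Md; apply: WM.
by rewrite -[x]mulr1; apply: v1 => a /sW[_]; rewrite mulrC.
Qed.

(** The argument of [dom_local] is repeated with the multipliers of [x] into [A] in place of its
    denominators. *)
Lemma tclos_local A x : ideal R A -> nonzero A -> R x ->
  (forall M, t_maximal R M -> exists d, [/\ R d, ~ M d & A (d * x)]) -> tclos R A x.
Proof.
move=> iA nA Rx locx; have [sA AR] := iA; pose W := [set r | R r /\ A (r * x)].
have iW : ideal R W.
  split; last by move=> r [].
  split; first by split; rewrite ?mul0r; [apply: dom0 | apply: sub0].
  split=> [a b [Ra Aax] [Rb Abx]|r a Rr [Ra Aax]].
    by split; rewrite ?mulrDl; [apply: domD | apply: subD].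
  by split; rewrite -?mulrA; [apply: domM | apply: subMl].
have nW : nonzero W.
  have [a [Aa a0]] := nA; exists a; split=> //.
  by split; [apply: AR | apply: subMr].
have [M maxM WM|s sW v1] := tclos1 _ iW nW.
  have [d [Rd Md Adx]] := locx M maxM.
  by apply: Md; apply: WM.
apply/tclosP => //; exists [seq a * x | a <- s].
  by move=> _ /mapP[a /sW[_ Aax] ->].
move=> y ys; rewrite -[y * x]mulr1; apply: v1 => a sa.
by rewrite -mulrA [x * a]mulrC; apply: ys; apply: map_f.
Qed.

(* The contraction to [R] of the radical of [H R_M]. *)
Definition locrad (M H : set K) : set K :=
  [set y | R y /\ exists d n, [/\ R d, ~ M d & H (d * y ^+ n)]].

Lemma sub_locrad M H : prime_ideal R M -> ideal R H -> H `<=` locrad M H.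
Proof.
move=> [_ [M1 _]] [_ HR] x Hx; split; first exact: HR.
by exists 1, 1%N; split; rewrite ?mul1r //; apply: dom1.
Qed.

Lemma locrad_sub M H : prime_ideal R M -> H `<=` M -> locrad M H `<=` M.
Proof.
move=> pM HM y [Ry [d [n [Rd Md /HM Hdy]]]].
by apply: primeX (prime_cancel _ _ _ pM Rd (domX _ n Ry) Md Hdy).
Qed.

(** In the valuation domain [R_M] the radical of a proper ideal is prime, and so is its
    contraction. *)
Lemma locrad_prime M H : essential M -> ideal R H -> H `<=` M ->
  prime_ideal R (locrad M H).
Proof.
move=> eM iH HM; have [pM _ _] := eM; have [sH HR] := iH; have [_ [M1 _]] := pM.
have sub := locrad_sub _ _ pM HM.
(* When [b] divides [a] at [M], [(e (a + b))^n] is a multiple of [b^n]. *)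
have powM d a b e r n : R d -> R e -> R r -> ~ M d -> ~ M e ->
    R a -> R b -> e * a = b * r -> H (d * b ^+ n) ->
    locrad M H (a + b).
  move=> Rd Re Rr Md Me Ra Rb er Hd; split; first exact: domD.
  exists (d * e ^+ n), n; split; first by apply: domM => //; apply: domX.
    apply: primeM => //; first exact: domX.
    by move/primeX; apply: contra_not Me; apply.
  rewrite -mulrA -exprMn mulrDr er (_ : b * r + e * b = b * (r + e)); last by ring.
  by rewrite exprMn mulrA; apply: subMr => //; apply: domX; apply: domD.
(* When [b] divides [a] at [M], [e^n a^(2n)] is a multiple of [(a b)^n]. *)
have mulM d a b e r n : R d -> R e -> R r -> ~ M d -> ~ M e ->
    R a -> R b -> e * a = b * r -> H (d * (a * b) ^+ n) ->
    locrad M H a.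
  move=> Rd Re Rr Md Me Ra Rb er Hd; split=> //.
  exists (d * e ^+ n), (n + n)%N; split; first by apply: domM => //; apply: domX.
    apply: primeM => //; first exact: domX.
    by move/primeX; apply: contra_not Me; apply.
  rewrite exprD (_ : _ * _ = d * a ^+ n * (e * a) ^+ n); last by rewrite exprMn; ring.
  rewrite er (_ : _ * _ = d * (a * b) ^+ n * r ^+ n); last by rewrite !exprMn; ring.
  by apply: subMr => //; apply: domX.
split.
  split; last by move=> y [].
  split; first by apply: sub_locrad => //; apply: sub0.
  split=> [a b [Ra [d [n [Rd Md Hd]]]] [Rb [d' [n' [Rd' Md' Hd']]]]
          |c y Rc [Ry [d [n [Rd Md Hd]]]]].
    have [e [Re Me [[r Rr er]|[r Rr er]]]] := essential_cmp _ a b eM.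
      exact: (powM d' a b e r n').
    by rewrite addrC; apply: (powM d b a e r n).
  split; first exact: domM.
  by exists d, n; split=> //; rewrite exprMn mulrCA; apply: subMl => //; apply: domX.
split; first by move/sub.
move=> a b Ra Rb [_ [d [n [Rd Md Hd]]]].
have [e [Re Me [[r Rr er]|[r Rr er]]]] := essential_cmp _ a b eM.
  by left; apply: (mulM d a b e r n).
by right; apply: (mulM d b a e r n) => //; rewrite [b * a]mulrC.
Qed.

(** * The t-primes of a PvMD *)

Hypothesis pvmdR : PvMD R.

Lemma t_maximal_essential M : t_maximal R M -> essential M.
Proof.
move=> maxM; split; [exact: t_maximal_prime| |exact: pvmdR].
by case: maxM => -[_ []].
Qed.

Lemma t_prime_sub_max P : t_prime R P -> exists2 M, t_maximal R M & P `<=` M.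
Proof. by move=> [[_ [P1 _]] tP]; apply: t_ideal_sub_max. Qed.

Lemma t_prime_essential P : t_prime R P -> essential P.
Proof.
move=> tP; have [M maxM PM] := t_prime_sub_max _ tP; have [pP [_ [nP _]]] := tP.
exact: essential_sub (t_maximal_essential _ maxM) pP nP PM.
Qed.

Lemma t_maximal_t_prime M : t_maximal R M -> t_prime R M.
Proof. by move=> maxM; split; [apply: t_maximal_prime | case: maxM]. Qed.

Lemma t_prime_sub P Q : t_prime R Q -> prime_ideal R P -> nonzero P -> P `<=` Q ->
  t_prime R P.
Proof.
move=> tQ pP nP PQ; apply: essential_t_prime.
exact: essential_sub (t_prime_essential _ tQ) pP nP PQ.
Qed.

(** Take [a] in [Q1] outside [Q2] and [b] in [Q2] outside [Q1]: one divides the other at [P], which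
    forces the multiple into the wrong prime. *)
Lemma t_prime_total P Q1 Q2 : t_prime R P -> prime_ideal R Q1 -> prime_ideal R Q2 ->
  Q1 `<=` P -> Q2 `<=` P -> Q1 `<=` Q2 \/ Q2 `<=` Q1.
Proof.
move=> tP pQ1 pQ2 Q1P Q2P; apply: contrapT => /not_orP[].
move=> /existsNP[a /not_implyP[Q1a Q2a]] /existsNP[b /not_implyP[Q2b Q1b]].
have cancel Q x y d r : prime_ideal R Q -> Q `<=` P -> Q y -> ~ Q x -> R x -> R d ->
    ~ P d -> R r -> d * x = y * r -> False.
  move=> pQ QP Qy Qx Rx Rd Pd Rr dx; apply: Qx; apply: (prime_cancel _ d) => //.
    by move/QP.
  by rewrite dx; apply: subMr => //; case: pQ => -[].
have Ra : R a by case: pQ1 => -[_ Q1R _]; apply: Q1R.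
have Rb : R b by case: pQ2 => -[_ Q2R _]; apply: Q2R.
have [d [Rd Pd [[r Rr e]|[r Rr e]]]] := essential_cmp _ a b (t_prime_essential _ tP).
  exact: (cancel Q2 a b d r).
exact: (cancel Q1 b a d r).
Qed.

(* With D = (R : (1, y)), the ideal W = D + D y lies in no t-maximal ideal, as y
   or 1/y lies in each localization; so already finitely many elements of W lie in no t-prime,
   and their coefficients in D suffice. *)
Lemma denominators_finite y :
  exists2 s, lsub s [set r | R r /\ R (r * y)] &
    forall P, t_prime R P -> lsub s P -> [set r | R r /\ R (r * y)] `<=` P.
Proof.
pose D := [set r | R r /\ R (r * y)].
have D0 : D 0 by split; rewrite ?mul0r; apply: dom0.
have DD a b : D a -> D b -> D (a + b).
  by move=> [Ra Ray] [Rb Rby]; split; rewrite ?mulrDl; apply: domD.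
have DM r a : R r -> D a -> D (r * a).
  by move=> Rr [Ra Ray]; split; rewrite -?mulrA; apply: domM.
pose W := [set h | exists a b, [/\ D a, D b & h = a + b * y]].
have DW : D `<=` W by move=> a Da; exists a, 0; split; rewrite ?mul0r ?addr0.
have iW : ideal R W.
  split; last by move=> _ [a [b [[Ra _] [_ Rby] ->]]]; apply: domD.
  split; first exact: DW.
  split=> [_ _ [a [b [Da Db ->]]] [a' [b' [Da' Db' ->]]]|r _ Rr [a [b [Da Db ->]]]].
    by exists (a + a'), (b + b'); split; [apply: DD|apply: DD|ring].
  by exists (r * a), (r * b); split; [apply: DM|apply: DM|ring].
have nW : nonzero W.
  have [_ [qf _]] := domR; have [a [b [Ra [Rb [b0 ey]]]]] := qf y.
  by exists b; split=> //; apply: DW; split=> //; rewrite ey mulrC divfK.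
have [M maxM WM|w wW wP] := t_finite_char _ iW nW.
  have [d [Rd Md dW]] := essential_cmp _ y 1 (t_maximal_essential _ maxM).
  (* Either [d y] is in [R], so that [d] is in [D], or [d = y r] with [r] in [D]. *)
  apply: Md; apply: WM; case: dW => -[r Rr].
    by rewrite mul1r => e; apply: DW; split; rewrite // e.
  rewrite mulr1 => e; exists 0, r; split=> //; last by rewrite e add0r mulrC.
  by split; rewrite // mulrC -e.
have [h s s' [a [b [sa sb ->]]] ss'|h /wW[a [b [Da Db eh]]]|s sD sw] :=
    @seq_collect D (fun h s => exists a b, [/\ a \in s, b \in s & h = a + b * y]) w.
- by exists a, b; split=> //; apply: ss'.
- exists [:: a; b]; first by apply: lsub_cons => //; apply: lsub_cons.
  by exists a, b; split=> //; rewrite !inE eqxx ?orbT.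
(* If [d] were outside [P], every [h = a + b y] in [w] would lie in [P], because
   [d h = d a + (d y) b] with [a] and [b] in [P]. *)
exists s => // P tP sP d [Rd Rdy]; apply: contrapT => Pd.
have [pP _] := tP; have [[sbP _] _] := pP.
apply: (wP P tP) => h wh; have [a [b [sa sb eh]]] := sw h wh.
have [_ WR] := iW; apply: (prime_cancel _ d) => //; first exact/WR/wW.
rewrite eh (_ : _ * _ = d * a + d * y * b); last by ring.
by apply: subD => //; apply: subMl => //; apply: sP.
Qed.

(** * Radically finite t-ideals *)

(* By [radical_t_ideal_bigcap] this is the intersection of the t-primes
   containing [A] (for nonzero [A] inside [R]), in a visibly finitary form. *)
Definition tradical (A : set K) : set K :=
  [set x | R x /\ exists2 s, lsub s A & forall Q, t_prime R Q -> lsub s Q -> Q x].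

Definition radfin (A : set K) : Prop :=
  exists2 s, lsub s A & forall Q, t_prime R Q -> lsub s Q -> A `<=` Q.

Lemma tradical_collect A w : lsub w (tradical A) ->
  exists2 s, lsub s A & forall Q, t_prime R Q -> lsub s Q -> lsub w Q.
Proof.
move=> wA.
have [x s s' sP ss' Q tQ s'Q|x /wA[]//|s sA sw] :=
    @seq_collect A (fun x s => forall Q, t_prime R Q -> lsub s Q -> Q x) w.
  by apply: sP => // a /ss'; apply: s'Q.
by exists s => // Q tQ sQ x /sw; apply.
Qed.

Lemma sub_tradical A : A `<=` R -> A `<=` tradical A.
Proof.
move=> AR x Ax; split; first exact: AR.
exists [:: x]; first by apply: lsub_cons.
by move=> Q _ /lsub_consE[].
Qed.

Lemma tradical_sub A Q : t_prime R Q -> A `<=` Q -> tradical A `<=` Q.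
Proof. by move=> tQ AQ x [_ [s sA]]; apply=> //; apply: lsub_trans sA AQ. Qed.

Lemma tradical_radical_t_ideal A : A `<=` R -> nonzero A ->
  radical_t_ideal R (tradical A).
Proof.
move=> AR nA; have sQ Q : t_prime R Q -> submodule R Q by case=> -[[]].
split; last first.
  move=> x [Rx [n [_ [s sA sx]]]]; split=> //; exists s => // Q tQ /(sx _ tQ).
  by apply: primeX => //; case: tQ.
apply: t_idealP.
- split; last by move=> x [].
  split; first by split; [apply: dom0 | exists [::] => // Q /sQ /sub0].
  split=> [x y [Rx [s sA sx]] [Ry [s' s'A s'y]]|r x Rr [Rx [s sA sx]]].
    split; first exact: domD.
    exists (s ++ s'); first exact/lsub_cat.
    move=> Q tQ /lsub_cat[/(sx _ tQ) Qx /(s'y _ tQ) Qy].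
    by apply: subD Qx Qy; apply: sQ.
  split; first exact: domM.
  by exists s => // Q tQ /(sx _ tQ) Qx; apply: subMl Rr Qx; apply: sQ.
- by have [a [Aa a0]] := nA; exists a; split=> //; apply: sub_tradical.
move=> s x sA vx Rx; split=> //; have [s' s'A s's] := tradical_collect _ _ sA.
exists s' => // Q tQ /(s's _ tQ) sQ'; apply: t_ideal_vgen sQ' vx.
by case: tQ.
Qed.

(** Membership is checked at each t-maximal [M]. If [M] contains [I], then [locrad M I] is a t-prime
    above [I], hence contains [x]. *)
Lemma radical_t_ideal_bigcap I x : radical_t_ideal R I -> R x ->
  (forall Q, t_prime R Q -> I `<=` Q -> Q x) -> I x.
Proof.
move=> [[iI [nI TI]] rI] Rx Ix; have [sI IR] := iI; rewrite -TI.
apply: tclos_local => // M maxM.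
have eM := t_maximal_essential _ maxM; have [pM _ _] := eM.
have [IM|] := pselect (I `<=` M); last first.
  move=> /existsNP[d /not_implyP[Id Md]]; exists d.
  by split=> //; [apply: IR | apply: subMr].
have [_ [d [n [Rd Md Id]]]] : locrad M I x.
  apply: Ix; last exact: sub_locrad.
  apply: (t_prime_sub _ M); first exact: t_maximal_t_prime.
  - exact: locrad_prime.
  - by have [a [Ia a0]] := nI; exists a; split=> //; apply: sub_locrad.
  - exact: locrad_sub.
exists d; split=> //; apply: rI; split; first exact: domM.
(* The exponent is [n.+1] because [n] may be 0, when only [d] itself is known to be in [I]. *)
exists n.+1; rewrite exprMn (_ : _ * _ = d ^+ n * x * (d * x ^+ n)).
  by apply: subMl => //; apply: domM => //; apply: domX.
by rewrite !exprS; ring.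
Qed.

(** As in Cohen's theorem, a radical t-ideal [H] maximal among those that are not radically finite
    is prime, which contradicts the hypothesis on t-primes. *)
Lemma radfin_radical_t_ideal I : (forall P, t_prime R P -> radfin P) ->
  radical_t_ideal R I -> radfin I.
Proof.
move=> finP rI; apply: contrapT => nfI.
have [//|F F0 Fg Ft|H [_ [rH nfH] Hmax]] :=
    @zorn_above K (fun B => radical_t_ideal R B /\ ~ radfin B) I.
  split.
    split; first by apply: t_ideal_bigcup => // X /Fg[[]].
    move=> x [Rx [n [X FX Xx]]]; exists X => //; have [[_ rX] _] := Fg _ FX.
    by apply: rX; split=> //; exists n.
  move=> [s sU fs]; have [X FX sX] := chain_lsub _ _ F0 Ft sU.
  have [_] := Fg _ FX; apply; exists s => // Q tQ /(fs _ tQ) UQ x Xx.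
  by apply: UQ; exists X.
have [[iH [nH TH]] radH] := rH; have [sH HR] := iH.
(* By maximality the radical t-ideal generated by [H] and [a] is radically finite; a finite witness
   consists of members of [H] and possibly [a]. *)
have adjoin a : R a -> ~ H a ->
    exists2 u, lsub u H & forall Q, t_prime R Q -> lsub u Q -> Q a -> H `<=` Q.
  move=> Ra Ha; pose B := H `|` [set a].
  have BR : B `<=` R by move=> x [/HR|->].
  have HB : H `<=` tradical B by move=> x Hx; apply: sub_tradical => //; left.
  have rB : radical_t_ideal R (tradical B).
    apply: tradical_radical_t_ideal => //.
    by have [x [Hx x0]] := nH; exists x; split=> //; left.
  have [s sB fs] : radfin (tradical B).
    apply: contrapT => nfB; apply: Ha.
    have <- : tradical B = H by apply: Hmax.
    by apply: sub_tradical => //; right.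
  have [s' s'B s's] := tradical_collect _ _ sB.
  exists [seq x <- s' | `[< H x >]]; first by move=> x; rewrite mem_filter => /andP[/asboolP].
  move=> Q tQ uQ Qa x Hx; apply: (fs Q tQ _ x); last exact: HB.
  apply: s's => // y s'y; case: (s'B y s'y) => [Hy|-> //].
  by apply: uQ; rewrite mem_filter s'y andbT; apply/asboolP.
apply: (nfH); apply: finP; split; last by case: rH.
split=> //; split.
  (* No t-prime contains [[:: 1]], so this list would make [H] radically finite vacuously. *)
  move=> H1; apply: (nfH); exists [:: 1]; first by apply: lsub_cons.
  by move=> Q [[_ [Q1 _]] _] /lsub_consE[].
move=> a b Ra Rb Hab; apply: contrapT => /not_orP[Ha Hb].
have [u1 u1H f1] := adjoin a Ra Ha; have [u2 u2H f2] := adjoin b Rb Hb.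
apply: nfH; exists (a * b :: u1 ++ u2).
  by apply: lsub_cons => //; apply/lsub_cat.
move=> Q tQ /lsub_consE[Qab /lsub_cat[u1Q u2Q]].
have [[_ [_ pQ]] _] := tQ.
by case: (pQ a b Ra Rb Qab) => [/(f1 _ tQ u1Q)|/(f2 _ tQ u2Q)].
Qed.

Lemma chain_mono (c : nat -> set K) : (forall n, c n `<=` c n.+1) ->
  forall m n, (m <= n)%N -> c m `<=` c n.
Proof.
move=> cS m n /subnK <-; elim: (n - m)%N => // k IHk x /IHk.
by rewrite addSn; apply: cS.
Qed.

(** The union of the chain is radically finite, and its finite list already lies in some [c N]; from
    there on the same t-primes contain every member. *)
Lemma radfin_ACC : (forall P, t_prime R P -> radfin P) -> ACC (radical_t_ideal R).
Proof.
move=> finP c rc cS; have cmono := chain_mono _ cS.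
pose F := [set c n | n in [set: nat]].
have F0 : F !=set0 by exists (c 0%N), 0%N.
have Ft : total_on F subset.
  move=> _ _ [m _ <-] [n _ <-].
  by case/orP: (leq_total m n) => /cmono; [left | right].
have [|s sU fs] := radfin_radical_t_ideal (\bigcup_(X in F) X) finP.
  split; first by apply: t_ideal_bigcup => // _ [n _ <-]; case: (rc n).
  move=> x [Rx [n [_ [m _ <-] cx]]]; exists (c m); first by exists m.
  by have [_ rm] := rc m; apply: rm; split=> //; exists n.
have [_ [N _ <-] sN] := chain_lsub _ _ F0 Ft sU.
exists N => n leNn; apply/seteqP; split=> [x cx|]; last exact: cmono.
apply: radical_t_ideal_bigcap; first exact: rc.
  by have [[[_ cR] _] _] := rc n; apply: cR.
move=> Q tQ NQ; apply: (fs Q tQ); first exact: lsub_trans sN NQ.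
by exists (c n) => //; exists n.
Qed.

(** Otherwise any finite list in [P] can be extended by an element of [P] missed by some t-prime
    above the list; the t-radicals of the successive lists increase strictly. *)
Lemma ACC_radfin P : ACC (radical_t_ideal R) -> t_prime R P -> radfin P.
Proof.
move=> accR [[[sP PR] _] [_ [[p [Pp p0]] _]]]; apply: contrapT => nfP.
(* For lists not contained in [P] the value 0 is a dummy. *)
have /choice[f fP] (s : seq K) : exists x, lsub s P ->
    P x /\ exists Q, [/\ t_prime R Q, lsub s Q & ~ Q x].
  have [sPs|] := pselect (lsub s P); last by exists 0.
  apply: contrapT => nx; apply: nfP; exists s => // Q tQ sQ x Px.
  apply: contrapT => Qx; apply: nx; exists x => _; split=> //.
  by exists Q.
pose u n := iter n (fun s => f s :: s) [:: p].
have uP n : lsub (u n) P.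
  elim: n => [|n IHn]; first by apply: lsub_cons.
  by apply: lsub_cons => //; case: (fP _ IHn).
have uR n : [set x | x \in u n] `<=` R by move=> x /uP/PR.
pose c n := tradical [set x | x \in u n].
have cS n : c n `<=` c n.+1.
  move=> x [Rx [s su sx]]; split=> //; exists s => // a /su ua.
  by rewrite /= inE ua orbT.
have [n|N /(_ N.+1 (leqnSn N)) eN] := accR c _ cS.
  apply: tradical_radical_t_ideal => //; exists p; split=> //=.
  by elim: n => [|n IHn]; rewrite /= inE ?eqxx ?IHn ?orbT.
have [_ [Q [tQ uQ]]] := fP _ (uP N); apply.
suff: c N (f (u N)) by apply: tradical_sub.
rewrite -eN; apply: (sub_tradical _ (uR _)).
exact: mem_head.
Qed.

Lemma radfin_t_sharpsharp : (forall P, t_prime R P -> radfin P) -> t_sharpsharp R.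
Proof.
move=> finP F1 F2 tF1 tF2 inc1 inc2 neF eqI; apply: neF.
(* If no [Q] in [G2] contained [P], some [a] in [s] outside [Q] would clear the denominator of
   [d / g], so [d / g] would lie in every [R_Q]. It is not in [R_P], since [g] is in [P] and [d] is
   not. *)
have above G1 G2 P : G1 `<=` t_prime R -> G2 `<=` t_prime R ->
    loc_inter R G1 = loc_inter R G2 -> G1 P -> exists2 Q, G2 Q & P `<=` Q.
  move=> tG1 tG2 eG G1P; apply: contrapT => nQ.
  have tP := tG1 _ G1P; have [pP [_ [[p [Pp p0]] _]]] := tP.
  have [s sP fs] := finP _ tP.
  have [|g sg [d [Rd Pd g0 dg]]] :=
      essential_inverse _ (p :: s) p (t_prime_essential _ tP) _ p0.
    exact: mem_head.
  have : loc_inter R G2 (d / g).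
    move=> Q G2Q; have [pQ _] := tG2 _ G2Q.
    have /existsNP[a /not_implyP[sa Qa]] : ~ lsub s Q.
      by move=> sQ; apply: nQ; exists Q => //; apply: fs => //; apply: tG2.
    apply/localizationP; first exact: prime0.
    exists a; split=> //; first by have [[_ PR] _] := pP; apply/PR/sP.
    by rewrite mulrC; apply: dg; rewrite inE sa orbT.
  rewrite -eG => /(_ P G1P)/(localizationP _ _ (prime0 _ pP))[e [Re Pe Red]].
  have Pg : P g by move: sg; rewrite inE => /predU1P[->|/sP].
  have [[sub _] _] := pP.
  apply: (primeM _ _ _ pP Re Rd Pe Pd).
  rewrite (_ : e * d = e * (d / g) * g); last by field.
  exact: subMl.
(* Going up twice gives [P] below [Q] below [P'] with [P] and [P'] in [G1]; incomparability
   collapses the three. *)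
have incl G1 G2 : G1 `<=` t_prime R -> G2 `<=` t_prime R -> incomparable_family G1 ->
    loc_inter R G1 = loc_inter R G2 -> G1 `<=` G2.
  move=> tG1 tG2 inc eG P G1P.
  have [Q G2Q PQ] := above _ _ _ tG1 tG2 eG G1P.
  have [P' G1P' QP'] := above _ _ _ tG2 tG1 (esym eG) G2Q.
  have eP : P = P' by apply: inc => //; apply: subset_trans PQ QP'.
  by suff -> : P = Q by []; apply/seteqP; split=> //; rewrite eP.
by apply/seteqP; split; apply: incl.
Qed.

(** * Sharp and branched primes *)

Definition sharp (P : set K) : Prop :=
  exists2 s, lsub s P & forall M, t_maximal R M -> lsub s M -> P `<=` M.

(** Adding [P] to the t-maximal ideals not containing it must change the intersection, so some [y]
    outside [R_P] lies in all their localizations. Finitely many denominators of [y] then witness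
    sharpness. *)
Lemma t_sharpsharp_sharp P : t_sharpsharp R -> t_prime R P -> sharp P.
Proof.
move=> shR tP; pose F1 := [set M | t_maximal R M /\ ~ P `<=` M].
have tF1 : F1 `<=` t_prime R by move=> M [/t_maximal_t_prime].
have maxE M M' : t_maximal R M -> t_prime R M' -> M `<=` M' -> M = M'.
  by move=> maxM [[_ [M'1 _]] tM'] MM'; rewrite (t_maximal_sub _ _ maxM tM').
have neI : loc_inter R F1 <> loc_inter R (F1 `|` [set P]).
  apply: shR => //.
  - by move=> M [/tF1|->].
  - by move=> M M' [maxM _] F1M'; apply: maxE => //; apply: tF1.
  - move=> M M' [[maxM PM]|->] [F1M'|->] //.
    + by apply: maxE => //; apply: tF1.
    + exact: maxE.
    + by case: F1M'.
  - move=> eF; have : F1 P by rewrite eF; right.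
    by case=> _ /(_ (fun _ => id)).
have [y yF1 yP] : exists2 y, loc_inter R F1 y & ~ localization R P y.
  apply: contrapT => ny; apply: neI; apply/seteqP; split=> y yF M.
    move=> [F1M|->]; first exact: yF.
    by apply: contrapT => yP; apply: ny; exists y.
  by move=> F1M; apply: yF; left.
have [pP _] := tP; have P0 := prime0 _ pP.
have [s sD fs] := denominators_finite y; exists s.
  move=> a /sD[Ra Ray]; apply: contrapT => Pa; apply: yP.
  by apply/(localizationP _ _ P0); exists a.
move=> M maxM sM; apply: contrapT => PM.
have pM := t_maximal_prime _ maxM.
have [|d [Rd Md Rdy]] := (localizationP _ _ (prime0 _ pM)).1 (yF1 M _); first by split.
by apply: Md; apply: (fs M) => //; apply: t_maximal_t_prime.
Qed.

(* If P is not sharp then (R : Q) lies in R_P for a P-primary ideal Q, so that Q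
   is its own trace; being a t-ideal, Q would then be radical, hence equal to P. *)
Lemma tRTP_sharp P : tRTP R -> t_prime R P -> branched R P -> sharp P.
Proof.
move=> trR tP [Q [qQ [radQ neQ]]]; apply: contrapT => nsP.
have [iQ [Q1 pQ]] := qQ; have [sQ QR] := iQ.
have [pP [_ [[p [Pp p0]] _]]] := tP; have P0 := prime0 _ pP.
have QP : Q `<=` P.
  by move=> x Qx; rewrite -radQ; split; [apply: QR | exists 1%N].
have nQ : nonzero Q.
  by move: Pp; rewrite -radQ => -[_ [n Qn]]; exists (p ^+ n); rewrite expf_neq0.
have Qcancel d x : R d -> ~ P d -> R x -> Q (d * x) -> Q x.
  move=> Rd Pd Rx; rewrite mulrC => /(pQ _ _ Rx Rd)[//|Qd].
  by case: Pd; rewrite -radQ.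
(* If [y] were outside [R_P], its denominators would lie in [P] and include [Q]. A t-maximal ideal
   containing the finite list [s] would contain [Q], hence its radical [P], making [P] sharp. *)
have invQ y : colon R Q y -> localization R P y.
  move=> Qy; apply: contrapT => yP; apply: nsP.
  have [s sD fs] := denominators_finite y; exists s.
    move=> a /sD[Ra Ray]; apply: contrapT => Pa; apply: yP.
    by apply/(localizationP _ _ P0); exists a.
  move=> M maxM sM x; rewrite -radQ => -[Rx [n Qx]].
  apply: (primeX _ _ n) => //; first exact: t_maximal_prime.
  apply: (fs M) => //; first exact: t_maximal_t_prime.
  by split; [apply: QR | rewrite mulrC; apply: Qy].
(* A multiplier [d] outside [P] brings each product back into [Q], and can be cancelled because [Q]
   is primary with radical [P]. *)
have traceQ : prodm Q (colon R Q) = Q.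
  apply/seteqP; split=> [_ [n [a [b [ab ->]]]]|x Qx]; last first.
    exists 1%N, (fun _ => x), (fun _ => 1); split; last by rewrite big_ord1 mulr1.
    by move=> _; split=> // c /QR; rewrite mul1r.
  apply: sub_sum => // i; have [Qa Qb] := ab i.
  have [d [Rd Pd Rdb]] := (localizationP _ _ P0).1 (invQ _ Qb).
  apply: (Qcancel d) => //; first by rewrite mulrC; apply: Qb.
  by rewrite mulrCA; apply: subMr.
have tQ : tclos R Q = Q.
  apply/seteqP; split; last exact: sub_tclos.
  move=> x Tx; have Rx := tclos_dom _ iQ nQ _ Tx.
  have [d [Rd Pd Qdx]] := essential_tclos _ _ _ (t_prime_essential _ tP) iQ nQ Tx.
  exact: Qcancel Qdx.
have := trR Q iQ nQ; rewrite traceQ tQ; case=> [eQ|].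
  by apply: Q1; rewrite eQ; apply: dom1.
by rewrite /radical radQ => PQ; apply: neQ; apply/seteqP.
Qed.

(** Equivalently, [P] is a minimal prime over the nonzero principal ideal [x R]. *)
Definition summit (P : set K) (x : K) : Prop :=
  [/\ P x, x != 0 & forall Q, prime_ideal R Q -> Q `<=` P -> Q x -> P `<=` Q].

(** Otherwise every nonzero element of [P] lies in a smaller t-prime; as primes below [P] are
    comparable, these yield a strictly increasing sequence. *)
Lemma ACC_summit P : ACC (t_prime R) -> t_prime R P -> exists x, summit P x.
Proof.
move=> accR tP; apply: contrapT => nx.
have [pP [_ [[p [Pp p0]] _]]] := tP.
have below x : P x -> x != 0 -> exists Q, [/\ t_prime R Q, Q `<=` P, Q x & ~ P `<=` Q].
  move=> Px x0; apply: contrapT => nQ; apply: nx; exists x; split=> // Q pQ QP Qx.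
  apply: contrapT => PQ; apply: nQ; exists Q; split=> //.
  by apply: t_prime_sub tP pQ _ QP; exists x.
pose low Q := [/\ t_prime R Q, Q `<=` P & ~ P `<=` Q].
have /choice[f fP] (Q : set K) : exists Q', low Q -> [/\ low Q', Q `<=` Q' & ~ Q' `<=` Q].
  have [[tQ QP PQ]|] := pselect (low Q); last by exists Q.
  have /existsNP[x /not_implyP[Px Qx]] := PQ; have [pQ _] := tQ.
  have [|Q' [tQ' Q'P Q'x PQ']] := below x Px.
    by apply/eqP => x0; apply: Qx; rewrite x0; apply: prime0.
  have [pQ' _] := tQ'; exists Q' => _; split=> //; last by move/(_ x Q'x).
  by case: (t_prime_total _ _ _ tP pQ pQ' QP Q'P) => // /(_ x Q'x).
have [Q0 [tQ0 Q0P _ PQ0]] := below p Pp p0.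
pose c n := iter n f Q0.
have lowc n : low (c n) by elim: n => // n /fP[].
have [n|n|N /(_ N.+1 (leqnSn N)) eN] := accR c.
- by case: (lowc n).
- by case: (fP _ (lowc n)).
have {}eN : f (c N) = c N := eN.
by have [_ _] := fP _ (lowc N); rewrite eN; apply.
Qed.

(** Any [x] in [P] outside the primary ideal [Q] works: at [P] it divides every element of [Q], so a
    prime below [P] containing [x] contains [Q] and hence its radical [P]. *)
Lemma branched_summit P : t_prime R P -> branched R P -> exists x, summit P x.
Proof.
move=> tP [Q [[[sQ QR] [Q1 pQ]] [radQ neQ]]]; have [pP _] := tP.
have QP : Q `<=` P.
  by move=> x Qx; rewrite -radQ; split; [apply: QR | exists 1%N].
have [x Px Qx] : exists2 x, P x & ~ Q x.
  apply: contrapT => nx; apply: neQ; apply/seteqP; split=> // x Px.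
  by apply: contrapT => Qx; apply: nx; exists x.
have Rx : R x by have [[_ PR] _] := pP; apply: PR.
exists x; split=> //; first by apply/eqP => x0; apply: Qx; rewrite x0; apply: sub0.
move=> Q' pQ' Q'P Q'x; have [[sQ' _] _] := pQ'.
have QQ' : Q `<=` Q'.
  move=> y Qy; have Ry := QR _ Qy.
  have [d [Rd Pd [[r Rr e]|[r Rr e]]]] := essential_cmp _ x y (t_prime_essential _ tP).
    have [//|[n Qd]] : Q x \/ exists n, Q (d ^+ n).
      by apply: pQ => //; rewrite mulrC e; apply: subMr.
    by case: Pd; rewrite -radQ; split=> //; exists n.
  apply: (prime_cancel _ d) => //; first by move/Q'P.
  by rewrite e; apply: subMr.
by move=> y; rewrite -radQ => -[Ry [n /QQ']]; apply: primeX.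
Qed.

(** The primary ideal is the contraction of [x^2 R_P]. Its radical is a prime below [P] containing
    [x], hence [P]; the square keeps [x] itself out. *)
Lemma summit_branched P x : t_prime R P -> summit P x -> branched R P.
Proof.
move=> tP [Px x0 topx]; have eP := t_prime_essential _ tP.
have [pP _] := tP; have [[sP PR] [P1 _]] := pP; have Rx := PR _ Px.
pose H := [set y | exists2 r, R r & y = x ^+ 2 * r].
have iH : ideal R H.
  split; last by move=> _ [r Rr ->]; apply: domM => //; apply: domX.
  split; first by exists 0; [apply: dom0 | rewrite mulr0].
  split=> [_ _ [r Rr ->] [r' Rr' ->]|c _ Rc [r Rr ->]].
    by exists (r + r'); [apply: domD | rewrite mulrDr].
  by exists (c * r); [apply: domM | rewrite mulrCA].
have HP : H `<=` P.
  by move=> _ [r Rr ->]; apply: subMr => //; rewrite expr2; apply: subMl.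
pose Q := [set y | R y /\ exists d, [/\ R d, ~ P d & H (d * y)]].
have [sH HR] := iH.
have PQ y : P y -> exists n, Q (y ^+ n).
  have pL := locrad_prime _ _ eP iH HP => Py.
  have [|Ry [d [n [Rd Pd Hd]]]] := topx _ pL (locrad_sub _ _ pP HP) _ y Py.
    split=> //; exists 1, 2%N; split=> //; first exact: dom1.
    by exists 1; [apply: dom1 | rewrite mulrC].
  by exists n; split; [apply: domX | exists d].
have radQ : Defs.rad R Q = P.
  apply/seteqP; split=> y; last by move=> Py; split; [apply: PR | apply: PQ].
  move=> [Ry [n [Ryn [d [Rd Pd /HP Pdy]]]]].
  exact: primeX (prime_cancel _ _ _ pP Rd Ryn Pd Pdy).
exists Q; split; last first.
  split=> // eQ; have [_ [d [Rd Pd [r Rr]]]] : Q x by rewrite eQ.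
  rewrite expr2 mulrC -mulrA => /(mulfI x0) ed.
  by apply: Pd; rewrite ed; apply: subMr.
split.
  split; last by move=> y [].
  split.
    split; first exact: dom0.
    by exists 1; split; rewrite ?mulr0; [apply: dom1| |apply: sub0].
  split=> [a b [Ra [d [Rd Pd Hd]]] [Rb [d' [Rd' Pd' Hd']]]|c y Rc [Ry [d [Rd Pd Hd]]]].
    split; first exact: domD.
    exists (d * d'); split; [exact: domM|exact: primeM|].
    rewrite (_ : _ * _ = d' * (d * a) + d * (d' * b)); last by ring.
    by apply: subD => //; apply: subMl.
  split; first exact: domM.
  by exists d; split=> //; rewrite mulrCA; apply: subMl.
split.
  by move=> [_ [d [Rd Pd]]]; rewrite mulr1 => /HP.
move=> a b Ra Rb [_ [d [Rd Pd Hd]]].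
have [Pb|Pb] := pselect (P b); first by right; apply: PQ.
left; split=> //; exists (d * b); split; [exact: domM|exact: primeM|].
by rewrite -mulrA [b * a]mulrC.
Qed.

(** Sharpness puts [P] and [Q] under a common t-maximal ideal, where they are comparable; [x]
    settles the case of [Q] below [P]. *)
Lemma sharp_radfin P x : t_prime R P -> sharp P -> summit P x -> radfin P.
Proof.
move=> tP [s sP fs] [Px _ topx]; exists (x :: s); first exact: lsub_cons.
move=> Q tQ /lsub_consE[Qx sQ]; have [M maxM QM] := t_prime_sub_max _ tQ.
have PM : P `<=` M by apply: fs => //; apply: lsub_trans sQ QM.
have [pP _] := tP; have [pQ _] := tQ.
have [//|QP] := t_prime_total _ _ _ (t_maximal_t_prime _ maxM) pP pQ PM QM.
exact: topx.
Qed.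

(** * Trace ideals *)

Section Trace.
Variable I : set K.
Hypotheses (iI : ideal R I) (nI : nonzero I).
Let sI : submodule R I := proj1 iI.
Let H := prodm I (colon R I).

Lemma sub_trace : I `<=` H.
Proof.
move=> x Ix; exists 1%N, (fun _ => x), (fun _ => 1); split; last by rewrite big_ord1 mulr1.
by move=> _; split=> // c; rewrite mul1r; apply: (proj2 iI).
Qed.

Lemma trace_ideal : ideal R H.
Proof.
split; last first.
  move=> _ [n [a [b [ab ->]]]]; apply: sub_sum; first by case: dom_ideal.
  by move=> i; have [Ia Ib] := ab i; rewrite mulrC; apply: Ib.
split; first by apply: sub_trace; apply: sub0.
split=> [_ _ [n [a [b [ab ->]]]] [n' [a' [b' [ab' ->]]]]|r _ Rr [n [a [b [ab ->]]]]].
  exists (n + n')%N, (fun i => match split i with inl j => a j | inr j => a' j end),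
    (fun i => match split i with inl j => b j | inr j => b' j end); split.
    by move=> i; case: split.
  rewrite big_split_ord /=; congr (_ + _); apply: eq_bigr => i _.
    by rewrite -/(unsplit (inl i)) unsplitK.
  by rewrite -/(unsplit (inr i)) unsplitK.
exists n, (fun i => r * a i), b; split.
  by move=> i; have [Ia Ib] := ab i; split=> //; apply: subMl.
by rewrite mulr_sumr; apply: eq_bigr => i _; rewrite mulrA.
Qed.

(** For [b] in [(R : I)] the product [y b] is again in [(R : I)], since [b I] lies in [H]. *)
Lemma trace_colon y : (forall h, H h -> R (y * h)) -> forall h, H h -> H (y * h).
Proof.
move=> yH _ [n [a [b [ab ->]]]]; exists n, a, (fun i => y * b i); split; last first.
  by rewrite mulr_sumr; apply: eq_bigr => i _; rewrite mulrCA.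
move=> i; have [Ia Ib] := ab i; split=> // c Ic; rewrite -mulrA; apply: yH.
exists 1%N, (fun _ => c), (fun _ => b i); split=> //.
by rewrite big_ord1 mulrC.
Qed.

End Trace.

(* [Hcolon] is the identity (R : H) = (H : H) of trace ideals ([trace_colon]).
   It is exploited through quotients d / g, where g generates at M a finitely
   generated ideal containing H at every t-maximal ideal above P; this yields
   first H R_P = H R_M ([trace_cancel]) and then P R_M = H R_M ([trace_locrad]). *)
Section TraceLocal.
Variables (H M : set K).
Hypotheses (iH : ideal R H) (nH : nonzero H) (maxM : t_maximal R M) (HM : H `<=` M).
Hypothesis Hcolon : forall y, (forall h, H h -> R (y * h)) -> forall h, H h -> H (y * h).
Let P := locrad M H.
Hypothesis finP : radfin P.

Let sH : submodule R H := proj1 iH.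
Let eM : essential M := t_maximal_essential M maxM.
Let pM : prime_ideal R M := t_maximal_prime M maxM.
Let pP : prime_ideal R P := locrad_prime M H eM iH HM.
Let PM : P `<=` M := locrad_sub M H pM HM.
Let HP : H `<=` P := sub_locrad M H pM iH.

(** By [Hcolon] it suffices that [d / g] maps [H] into [R], which is checked locally: above [P] by
    divisibility by [g], elsewhere by a member of [t] that clears the denominator. *)
Lemma trace_mul t d g : lsub t P ->
  (forall Q, t_prime R Q -> lsub t Q -> P `<=` Q) ->
  (forall a, a \in t -> R (d / g * a)) -> R d -> g != 0 ->
  (forall Q h, t_prime R Q -> P `<=` Q -> H h ->
     exists e, [/\ R e, ~ Q e & exists2 r, R r & e * h = g * r]) ->
  forall h, H h -> H (d / g * h).
Proof.
move=> tP ft dt Rd g0 gH; apply: Hcolon => h Hh; apply: dom_local => M' maxM'.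
have tM' := t_maximal_t_prime _ maxM'; have [pM' _] := tM'.
apply/localizationP; first exact: prime0.
have [PM'|nPM'] := pselect (P `<=` M').
  have [e [Re M'e [r Rr er]]] := gH M' h tM' PM' Hh; exists e; split=> //.
  by rewrite mulrCA er (_ : d / g * (g * r) = d * r); [apply: domM | field].
have /existsNP[a /not_implyP[ta M'a]] : ~ lsub t M'.
  by move=> tM; apply: nPM'; apply: ft.
have [_ HR] := iH; have [[_ PR] _] := pP.
exists a; split=> //; first exact/PR/tP.
by rewrite mulrA [a * _]mulrC; apply: domM; [apply: dt | apply: HR].
Qed.

(** When [z] is in [M], it generates [z :: t] at [M], as a generator inside [P] would force [z] into
    [P]. Multiplying [z x] by [d / z] then gives [d x] in [H]. *)
Lemma trace_cancel z x : R z -> ~ P z -> R x -> H (z * x) ->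
  exists d, [/\ R d, ~ M d & H (d * x)].
Proof.
move=> Rz Pz Rx Hzx; have [Mz|Mz] := pselect (M z); last by exists z.
have z0 : z != 0 := prime_neq0 _ _ pP Pz.
have [t tP ft] := finP.
have [|g gs [d [Rd Md g0 dg]]] := essential_inverse M (z :: t) z eM _ z0.
  exact: mem_head.
have [[_ PR] _] := pP.
have eg : g = z.
  move: gs; rewrite inE => /predU1P[//|/tP Pg]; case: Pz.
  apply: (prime_cancel _ d) => //; first by move/PM.
  rewrite (_ : d * z = d / g * z * g); last by field.
  by apply: subMl => //; [case: pP => -[] | apply: dg; apply: mem_head].
exists d; split=> //.
rewrite (_ : d * x = d / z * (z * x)); last by field.
apply: trace_mul tP ft _ Rd z0 _ _ Hzx.
  by move=> a ta; rewrite -eg; apply: dg; rewrite inE ta orbT.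
move=> Q h tQ PQ Hh.
have [e [Re Qe [[r Rr er]|[r Rr er]]]] := essential_cmp _ h z (t_prime_essential _ tQ).
  by exists e; split=> //; exists r.
case: Pz; apply: (prime_cancel _ e) => //; first by move/PQ.
by rewrite er; apply: subMr => //; [case: pP => -[] | apply: HP].
Qed.

Lemma trace_locrad x : P x -> exists d, [/\ R d, ~ M d & H (d * x)].
Proof.
move=> Px; have [[sP PR] _] := pP; have [t tP ft] := finP; have [_ HR] := iH.
have [|g gs [d [Rd Md gd]]] := essential_gen M (x :: t) eM; first by [].
have Pg : P g by move: gs; rewrite inE => /predU1P[->|/tP].
(* If [g] is in [H] locally at [P], [trace_cancel] finishes. If not, [g] divides every element of
   [H] at each t-prime above [P], and [d / g] maps [H] into itself. *)
have [[z [Rz Pz Hzg]]|nz] := pselect (exists z, [/\ R z, ~ P z & H (z * g)]).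
  have [r Rr dx] := gd x (mem_head _ _).
  have [||d' [Rd' Md' Hd']] := trace_cancel z (d * x) Rz Pz.
  - by apply: domM => //; apply: PR.
  - by rewrite dx mulrA; apply: subMr.
  by exists (d' * d); split; [exact: domM|exact: primeM|rewrite -mulrA].
have g0 : g != 0.
  apply/eqP => g0; apply: nz; exists 1; split; first exact: dom1.
    by case: pP => _ [].
  by rewrite g0 mulr0; apply: sub0.
have dt a : a \in t -> R (d / g * a).
  move=> ta; have [|r Rr da] := gd a; first by rewrite inE ta orbT.
  by rewrite mulrAC da mulrC mulKf.
have dH : forall h, H h -> H (d / g * h).
  apply: trace_mul tP ft dt Rd g0 _.
  move=> Q h tQ PQ Hh.
  have [e [Re Qe [[r Rr er]|[r Rr er]]]] := essential_cmp _ h g (t_prime_essential _ tQ).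
    by exists e; split=> //; exists r.
  case: nz; exists e; split=> //; first by move/PQ.
  by rewrite er; apply: subMr.
have [Rg [d' [n [Rd' Md' Hd']]]] := Pg.
(* Each multiplication by [d / g] trades a factor [g] for [d]; starting from [d' g^n] in [H] this
   puts [d' d^n] in [M], although neither factor is. *)
have descend k e : H (e * g ^+ k) -> H (e * d ^+ k).
  elim: k e => // k IHk e /dH; rewrite (_ : d / g * _ = e * d * g ^+ k).
    by move/IHk; rewrite -mulrA -exprS.
  by rewrite exprS; field.
have := primeM _ _ _ pM Rd' (domX d n Rd) Md'; case; last exact/HM/descend.
by move/(primeX _ _ _ pM Rd).
Qed.

End TraceLocal.

Lemma radfin_tRTP : (forall P, t_prime R P -> radfin P) -> tRTP R.
Proof.
(* [R] is itself radical, so the second alternative can be proved in every case. *)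
move=> finP I iI nI; right; set H := prodm I _.
have iH : ideal R H := trace_ideal I iI.
have nH : nonzero H.
  by have [x [Ix x0]] := nI; exists x; split=> //; apply: sub_trace.
move=> x [Rx [n Hxn]]; apply: tclos_local => // M maxM.
have eM := t_maximal_essential _ maxM; have [pM _ _] := eM; have [sH HR] := iH.
have [HM|] := pselect (H `<=` M); last first.
  move=> /existsNP[d /not_implyP[Hd Md]]; exists d.
  by split=> //; [apply: HR | apply: subMr].
apply: trace_locrad => //.
- exact: trace_colon.
- apply: finP; apply: (t_prime_sub _ M); first exact: t_maximal_t_prime.
  + exact: locrad_prime.
  + by have [a [Ha a0]] := nH; exists a; split=> //; apply: sub_locrad.
  + exact: locrad_sub.
split=> //; have [d [Rd Md Hd]] := essential_tclos _ _ _ eM iH nH Hxn.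
by exists d, n.
Qed.

End PruferVMultiplication.

(** * Assembling the equivalences *)

Theorem theorem1p11 (K : fieldType) (R : set K) :
  domain_with_qf R -> PvMD R ->
  [/\ (ACC (radical_t_ideal R) <-> (tRTP R /\ ACC (t_prime R))),
      (ACC (radical_t_ideal R) <-> (t_sharpsharp R /\ ACC (t_prime R))) &
      (ACC (radical_t_ideal R) <->
         (t_sharpsharp R /\ forall P, t_prime R P -> branched R P))].
Proof.
move=> domR pvmdR.
(* Prime t-ideals are radical, so their chains are among those of radical t-ideals. *)
have accP : ACC (radical_t_ideal R) -> ACC (t_prime R).
  move=> acc c tc; apply: acc => n; have [pP tP] := tc n; split=> // x [Rx [k]].
  exact: (primeX K R domR _ _ _ pP Rx).
have fin : ACC (radical_t_ideal R) -> forall P, t_prime R P -> radfin K R P.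
  by move=> acc P; apply: (ACC_radfin K R domR).
have brP : ACC (t_prime R) -> forall P, t_prime R P -> branched R P.
  move=> acc P tP; have [x] := ACC_summit K R domR pvmdR P acc tP.
  exact: (summit_branched K R domR pvmdR P x tP).
(* All three converses pass through this: branchedness supplies a summit, and with sharpness it
   gives radical finiteness. *)
have back : (forall P, t_prime R P -> branched R P) ->
    (forall P, t_prime R P -> sharp K R P) -> ACC (radical_t_ideal R).
  move=> br sh; apply: (radfin_ACC K R domR pvmdR) => P tP.
  have [x sx] := branched_summit K R domR pvmdR P tP (br P tP).
  exact: (sharp_radfin K R domR pvmdR P x tP (sh P tP) sx).
split; split.
- by move=> acc; split; [apply: (radfin_tRTP K R domR pvmdR (fin acc)) | apply: accP].
- move=> [tr /brP br]; apply: back => // P tP.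
  exact: (tRTP_sharp K R domR pvmdR P tr tP (br P tP)).
- by move=> acc; split; [apply: (radfin_t_sharpsharp K R domR pvmdR (fin acc)) | apply: accP].
- move=> [sh /brP br]; apply: back => // P tP.
  exact: (t_sharpsharp_sharp K R domR pvmdR P sh tP).
- move=> acc; split; first by apply: (radfin_t_sharpsharp K R domR pvmdR (fin acc)).
  exact/brP/accP.
- move=> [sh br]; apply: back => // P tP.
  exact: (t_sharpsharp_sharp K R domR pvmdR P sh tP).
Qed.
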